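(* Let $f\colon X\to\overline{\mathbb{R}}$ be a proper function and $x_0\in\operatorname{dom}f$. Then $\partial_c f(x_0)\subseteq\operatorname{dom}f^c$.
   Context: $X$ is a nontrivial separated (Hausdorff) real locally convex space with continuous dual $X^*$; $\langle x,x^*\rangle$ is the value of $x^*\in X^*$ at $x\in X$. $\overline{\mathbb{R}}=\mathbb{R}\cup\{\pm\infty\}$. $W:=X^*\times X^*\times\mathbb{R}$. For an extended-real-valued function $h$, $\operatorname{dom}h=\{h<+\infty\}$; $h$ is proper if it never takes the value $-\infty$ and $\operatorname{dom}h\neq\emptyset$. Coupling function: $c(x,(x^*,u^*,\alpha)):=\langle x,x^*\rangle$ if $\langle x,u^*\rangle<\alpha$, and $+\infty$ otherwise. The $c$-conjugate of $f$ is $f^c\colon W\to\overline{\mathbb{R}}$, $f^c(w):=\sup_{x\in X}\{c(x,w)-f(x)\}$, with the convention $(+\infty)-(+\infty)=-\infty$. $c$-subdifferential: for $f$ proper with $f(x_0)\in\mathbb{R}$, $\partial_c f(x_0)$ is the set of $w=(x^*,u^*,\alpha)\in W$ such that $\langle x_0,u^*\rangle<\alpha$ and $f(x)-f(x_0)\ge c(x,w)-c(x_0,w)$ for all $x\in X$. *)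

(* Defs.v *)
From HB Require Import structures.
From mathcomp Require Import all_boot all_order all_algebra.
From mathcomp Require Import all_classical all_reals all_analysis.

Set Implicit Arguments.
Unset Strict Implicit.
Unset Printing Implicit Defensive.
Import Order.TTheory GRing.Theory Num.Theory.
Import numFieldNormedType.Exports.
Local Open Scope classical_set_scope.
Local Open Scope ring_scope.
Local Open Scope ereal_scope.

Definition effective_domain (R : realType) (T : Type) (h : T -> \bar R) :
    set T :=
  [set t | h t < +oo].

Definition proper_function (R : realType) (T : Type) (h : T -> \bar R) : Prop :=
  (forall t, h t <> -oo) /\ effective_domain h !=set0.

(* [tvsType R] is the library's interface for locally convex spaces; it does
   not include the Hausdorff axiom. *)
Record continuous_dual (R : realType) (X : tvsType R) : Type := ContinuousDual {
  dual_linear :> {linear X -> R^o} ;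
  dual_continuous : continuous (dual_linear : X -> R^o)
}.

Definition dual_triple (R : realType) (X : tvsType R) : Type :=
  (continuous_dual X * continuous_dual X * R)%type.

Definition c_coupling (R : realType) (X : tvsType R)
    (x : X) (w : dual_triple X) : \bar R :=
  let: (xs, us, alpha) := w in
  if (us x < alpha)%R then (xs x)%:E else +oo.

(* The library's addition on [\bar R] satisfies [+oo - +oo = -oo], which is the
   convention required in the supremum. *)
Definition c_conjugate (R : realType) (X : tvsType R)
    (f : X -> \bar R) (w : dual_triple X) : \bar R :=
  ereal_sup [set c_coupling x w - f x | x in [set: X]].

(* Meaningful only for [f] proper and [f x0] finite. In that case
   [c_coupling x0 w] is finite too, by the first condition on [w], so neither
   difference below is of the form [+oo - +oo]. *)
Definition c_subdifferential (R : realType) (X : tvsType R)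
    (f : X -> \bar R) (x0 : X) : set (dual_triple X) :=
  [set w : dual_triple X | (w.1.2 x0 < w.2)%R /\
    forall x : X, f x - f x0 >= c_coupling x w - c_coupling x0 w].

(* Main.v *)
Require Import Defs.
From HB Require Import structures.
From mathcomp Require Import all_boot all_order all_algebra.
From mathcomp Require Import all_classical all_reals all_analysis.
From mathcomp Require Import lra.

Import Order.TTheory GRing.Theory Num.Theory.
Import numFieldNormedType.Exports.
Local Open Scope classical_set_scope.
Local Open Scope ring_scope.

(** Rearranging the subgradient inequality gives c(x, w) - f x <= c(x0, w) - f x0 for every [x]. The
    right side is real: [x0_lt] makes the coupling at [x0] finite, and properness with [x0_dom]
    makes [f x0] finite. It thus bounds the supremum defining the conjugate. *)

Theorem proposition4p1 (R : realType) (X : tvsType R)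
    (X_separated : hausdorff_space X)
    (X_nontrivial : exists x : X, x <> 0)
    (f : X -> \bar R) (f_proper : proper_function f)
    (x0 : X) (x0_dom : effective_domain f x0) :
  c_subdifferential f x0 `<=` effective_domain (c_conjugate f).
Proof.
case: f_proper => f_neq_ninfty _.
move=> [[xs us] alpha] [/= x0_lt subgrad].
apply: (@le_lt_trans _ _ (xs x0 - fine (f x0))%:E); last exact: ltry.
apply: ge_ereal_sup => _ [x _ <-].
move: (subgrad x) (f_neq_ninfty x) (f_neq_ninfty x0) x0_dom.
rewrite /c_coupling x0_lt /effective_domain /=.
case: (f x0) => [r0| |] //; case: (f x) => [r| |] //=.
(* With [f x] real, an infinite coupling at [x] would put [+oo] below the real number [r - r0], so
   only the finite branch survives. *)
- case: ifP => _ //=.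
  by rewrite -!EFinB !lee_fin lerBDr => le_r _ _ _; lra.
(* If [f x] is [+oo], the term is [-oo] even for an infinite coupling, by the convention on
   [+oo - +oo]. *)
- by move=> _ _ _ _; rewrite addeNy leNye.
Qed.
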